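(* Let $m,n,k\ge 0$ be integers. There is a bijection between $\mathrm{RP}(m,n)^{\star k}$ and the set of two cars parking functions with $n$ labels equal to $1$, $m$ labels equal to $2$, and $k$ decorated rises, which preserves the bistatistic $(\mathsf{dinv},\underline{\mathsf{area}})$.
   Context: **Reduced parallelogram polyominoes.** An $m\times n$ reduced parallelogram polyomino ($m,n\ge0$) is a pair $(\mathbf r,\mathbf g)$ of sequences $\mathbf r=(r_1,\dots,r_{m+n})$, $\mathbf g=(g_1,\dots,g_{m+n})$ with $r_i,g_i\in\{0,1\}$, $g_1+\dots+g_i\le r_1+\dots+r_i$ for all $i$, and $g_1+\dots+g_{m+n}=r_1+\dots+r_{m+n}=n$. (They encode a red and a green lattice path from $(0,0)$ to $(m,n)$, with $1$ = unit north step and $0$ = unit east step; red is weakly above green.) **Area word of a polyomino.** Form the sequence $(1,r_1,1-g_1,r_2,1-g_2,\dots,r_{m+n},1-g_{m+n},0)$ and read it as a path starting at height $0$, each $1$ being an up step ($+1$) and each $0$ a down step ($-1$). Label the heights $1,2,3,4,\dots$ by the letters of the ordered alphabet $0<\bar0<1<\bar1<2<\bar2<\cdots$. Reading the path from left to right, at each up step write the letter labelling the height at which that step ends. The resulting word is the area word. This gives a bijection from $m\times n$ reduced polyominoes to words of length $m+n+1$ starting with $0$, with exactly $m+1$ unbarred and $n$ barred letters, in which each letter is less than or equal to the successor (in the alphabet) of the letter to its left. The letters $i$ and $\bar i$ both have numerical value $i$. **Decorated polyominoes.** A rise of a polyomino is a pair of consecutive letters of the area word such that the first is barred and the second is its successor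 in the alphabet. $\mathrm{RP}(m,n)^{\star k}$ is the set of $m\times n$ reduced polyominoes together with a choice of $k$ distinct rises (the decorated rises); the unbarred letters of the decorated rises are called marked. On this set, $\mathsf{dinv}$ is the number of pairs of letters of the area word such that the one on the left is the successor, in the alphabet, of the one on the right, and $\underline{\mathsf{area}}$ is the sum of the values of all letters of the area word except the marked ones. **Two cars parking functions.** A parking function of size $N$ is a Dyck path of size $N$ (a lattice path from $(0,0)$ to $(N,N)$ with unit north and east steps staying weakly above the diagonal $y=x$) together with a positive integer label on each vertical step, strictly increasing from bottom to top in each column (i.e. along consecutive vertical steps with the same $x$-coordinate). A two cars parking function is one all of whose labels are in $\{1,2\}$. Number the rows (vertical steps) $1,\dots,N$ from bottom to top; let $\ell_i$ be the label in row $i$ and let $a_i$ be the number of full unit squares in row $i$ between the path and the diagonal (so $a_1=0$ and $0\le a_{i+1}\le a_i+1$). A rise of a parking function is an index $i\ge2$ with $a_i=a_{i-1}+1$; a parking function with $k$ decorated rises is a parking function with a choice of $k$ distinct rises. On these objects, $\underline{\mathsf{area}}=\sum a_i$ over all $i$ that are not decorated rises, and $\mathsf{dinv}$ is the number of pairs $i<j$ such that either $a_i=a_j$ and $\ell_i<\ell_j$, or $a_i=a_j+1$ and $\ell_i>\ell_j$. *)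

(* Defs.v *)
From mathcomp Require Import all_boot.

Set Implicit Arguments.
Unset Strict Implicit.
Unset Printing Implicit Defensive.

(* Indices are 0-based throughout. In a lattice path, [true] is a unit north
   step and [false] a unit east step; accordingly the values r_i, g_i in {0, 1}
   are booleans and [count id s] is the sum of the sequence s. *)

Record reduced_polyomino (m n : nat) := ReducedPolyomino {
  red : (m + n).-tuple bool;
  green : (m + n).-tuple bool;
  green_below_red :
    [forall i : 'I_(m + n), count id (take i.+1 green) <= count id (take i.+1 red)];
  green_total : count id green == n;
  red_total : count id red == n
}.

(* A letter is represented by its rank in the alphabet 0 < 0bar < 1 < 1bar < ...:
   the letter i is 2i, and the letter ibar is 2i+1. *)
Definition letter := nat.
Definition barred (a : letter) : bool := odd a.
Definition value (a : letter) : nat := a./2.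
Definition successor (a : letter) : letter := a.+1.

(* The heights 1, 2, 3, ... are labelled by the successive letters. *)
Definition letter_at_height (h : nat) : letter := h.-1.

(* [h] is the current height. The truncation in [h.-1] is harmless: the paths
   arising from reduced polyominoes never go below height 0. *)
Fixpoint up_step_letters (h : nat) (s : seq bool) : seq letter :=
  match s with
  | [::] => [::]
  | true :: s' => letter_at_height h.+1 :: up_step_letters h.+1 s'
  | false :: s' => up_step_letters h.-1 s'
  end.

Definition polyomino_steps m n (P : reduced_polyomino m n) : seq bool :=
  true :: flatten [seq [:: rg.1; ~~ rg.2] | rg <- zip (red P) (green P)]
       ++ [:: false].

Definition area_word m n (P : reduced_polyomino m n) : seq letter :=
  up_step_letters 0 (polyomino_steps P).

Lemma size_up_step_letters h s : size (up_step_letters h s) = count id s.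
Proof. by elim: s h => [|[] s IHs] h //=; rewrite IHs. Qed.

Lemma size_area_word m n (P : reduced_polyomino m n) :
  size (area_word P) = (m + n).+1.
Proof.
rewrite size_up_step_letters /= count_cat /= !addn0 add1n; congr _.+1.
have count_steps (r g : seq bool) : size r = size g ->
    count id (flatten [seq [:: rg.1; ~~ rg.2] | rg <- zip r g]) + count id g
    = count id r + size g.
  elim: r g => [|b r IHr] [|c g] //= [/IHr]; case: b; case: c => /=;
    rewrite ?add0n ?add1n ?addnS ?addSn => -> //.
have := count_steps (red P) (green P).
rewrite !size_tuple (eqP (green_total P)) (eqP (red_total P)) => /(_ erefl).
by rewrite addnC => /addnI.
Qed.

(* The rise formed by the letters at positions i and i+1 is indexed by i. *)
Definition polyomino_rise m n (P : reduced_polyomino m n) (i : 'I_(m + n)) : bool :=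
  let w := area_word P in
  barred (nth 0 w i) && (nth 0 w i.+1 == successor (nth 0 w i)).

Record decorated_polyomino (m n k : nat) := DecoratedPolyomino {
  polyomino :> reduced_polyomino m n;
  polyomino_decoration : {set 'I_(m + n)};
  polyomino_decorationP :
    polyomino_decoration \subset polyomino_rise polyomino;
  polyomino_decoration_card : #|polyomino_decoration| == k
}.

(* Since successors of barred letters are unbarred, the unbarred letter of the
   rise i is the second one, at position i+1. *)
Definition marked m n k (P : decorated_polyomino m n k) : {set 'I_(m + n).+1} :=
  [set lift ord0 i | i in polyomino_decoration P].

Definition polyomino_dinv m n k (P : decorated_polyomino m n k) : nat :=
  let w := area_word P in
  #|[set p : 'I_(m + n).+1 * 'I_(m + n).+1 |
      (p.1 < p.2) && (nth 0 w p.1 == successor (nth 0 w p.2))]|.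

Definition polyomino_area m n k (P : decorated_polyomino m n k) : nat :=
  \sum_(j < (m + n).+1 | j \notin marked P) value (nth 0 (area_word P) j).

Record dyck_path (N : nat) := DyckPath {
  steps :> (N + N).-tuple bool;
  steps_above_diagonal :
    [forall i : 'I_(N + N).+1,
      count_mem false (take i steps) <= count_mem true (take i steps)];
  steps_north_total : count_mem true steps == N
}.

(* The x-coordinates of the north steps of a path starting at abscissa x. *)
Fixpoint north_abscissae (x : nat) (s : seq bool) : seq nat :=
  match s with
  | [::] => [::]
  | true :: s' => x :: north_abscissae x s'
  | false :: s' => north_abscissae x.+1 s'
  end.

Definition abscissa N (D : dyck_path N) (i : 'I_N) : nat :=
  nth 0 (north_abscissae 0 D) i.

Record parking_function (N : nat) := ParkingFunction {
  path_of :> dyck_path N;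
  labels : N.-tuple nat;
  labels_positive : all (leq 1) labels;
  labels_increasing :
    [forall i : 'I_N, forall j : 'I_N,
      (j == i.+1 :> nat) && (abscissa path_of i == abscissa path_of j)
      ==> (tnth labels i < tnth labels j)]
}.

(* Row i is the strip i <= y <= i+1; its full squares between the path and the
   diagonal are those with left abscissa in [abscissa D i, i - 1]. *)
Definition row_area N (D : dyck_path N) (i : 'I_N) : nat := i - abscissa D i.

Definition parking_rise N (F : parking_function N) (i : 'I_N) : bool :=
  [exists j : 'I_N, (i == j.+1 :> nat) && (row_area F i == (row_area F j).+1)].

Record decorated_two_cars (m n k : nat) := DecoratedTwoCars {
  parking :> parking_function (m + n);
  two_cars : all (mem [:: 1; 2]) (labels parking);
  labels_one : count_mem 1 (labels parking) == n;
  labels_two : count_mem 2 (labels parking) == m;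
  parking_decoration : {set 'I_(m + n)};
  parking_decorationP : parking_decoration \subset parking_rise parking;
  parking_decoration_card : #|parking_decoration| == k
}.

Definition parking_dinv m n k (F : decorated_two_cars m n k) : nat :=
  let a := row_area F in
  let l := tnth (labels F) in
  #|[set p : 'I_(m + n) * 'I_(m + n) |
      (p.1 < p.2) &&
      ((a p.1 == a p.2) && (l p.1 < l p.2) ||
       (a p.1 == (a p.2).+1) && (l p.1 > l p.2))]|.

Definition parking_area m n k (F : decorated_two_cars m n k) : nat :=
  \sum_(i < m + n | i \notin parking_decoration F) row_area F i.

(* Main.v *)
(* Drop the first letter 0 of the area word and read the remaining letters from
   left to right as the rows of a parking function, a barred letter of value i
   as a row of area i with label 1, an unbarred one as a row of area i with
   label 2. "At most the successor of the previous letter" then says exactly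
   that areas increase by at most one, and that they do so only from a label 1
   to a label 2, i.e. that columns increase. Under this dictionary rises,
   marked letters, values and the pairs counted by dinv correspond; the dropped
   0 is unmarked, has value 0 and succeeds no letter.
   In both models the word is the sequence of heights of the up steps of a Dyck
   path, and such a path is determined by these heights. *)
Require Import Defs.
From mathcomp Require Import all_boot.
From mathcomp Require Import zify.

Set Implicit Arguments.
Unset Strict Implicit.
Unset Printing Implicit Defensive.

(** * Paths that end at height 0, and the heights of their up steps *)

Fixpoint descends_to_zero (h : nat) (s : seq bool) : bool :=
  match s with
  | [::] => h == 0
  | true :: s' => descends_to_zero h.+1 s'
  | false :: s' => (0 < h) && descends_to_zero h.-1 s'
  end.

(* The bound also holds beyond the end of [w], where [nth] returns 0. *)
Definition slowly_growing (w : seq nat) : Prop :=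
  forall i, nth 0 w i.+1 <= (nth 0 w i).+1.

(** Candidate inverse of [up_step_letters h]: the up step with letter [a] starts at height [a], so
    the path first descends there from [h], and after the last letter it descends to 0. *)
Fixpoint path_of_letters (h : nat) (w : seq nat) : seq bool :=
  match w with
  | [::] => nseq h false
  | a :: w' => nseq (h - a) false ++ true :: path_of_letters a.+1 w'
  end.

Lemma head_up_step_letters h s : nth 0 (up_step_letters h s) 0 <= h.
Proof. by elim: s h => [|[] s IHs] h //=; have := IHs h.-1; lia. Qed.

Lemma slowly_growing_up_step_letters h s :
  slowly_growing (up_step_letters h s).
Proof.
elim: s h => [|[] s IHs] h [|i] //=; try exact: IHs.
exact: head_up_step_letters.
Qed.

(** The first letter reveals the first step: it is [h] after an up step and at most [h.-1] after a
    down step. Once the letters run out, only down steps to height 0 remain. *)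
Lemma up_step_letters_inj h s t :
    descends_to_zero h s -> descends_to_zero h t ->
  up_step_letters h s = up_step_letters h t -> s = t.
Proof.
elim: s h t => [|[] s IHs] h [|[] t] //=.
- by move=> /eqP->.
- move=> Ds Dt [] E; congr (_ :: _); exact: IHs E.
- move=> _ /andP[h_gt0 _] E.
  by have := head_up_step_letters h.-1 t; rewrite -E /letter_at_height /=; lia.
- by move=> /andP[+ _] /eqP h0; rewrite h0.
- move=> /andP[h_gt0 _] _ E.
  by have := head_up_step_letters h.-1 s; rewrite E /letter_at_height /=; lia.
- move=> /andP[_ Ds] /andP[_ Dt] E; congr (_ :: _); exact: IHs E.
Qed.

Lemma descends_to_zero_nseq_cat h j s :
  j <= h -> descends_to_zero h (nseq j false ++ s) = descends_to_zero (h - j) s.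
Proof.
elim: j h => [|j IHj] h le_jh /=; first by rewrite subn0.
rewrite IHj; last lia.
by rewrite (leq_ltn_trans (leq0n j) le_jh) /=; congr descends_to_zero; lia.
Qed.

Lemma up_step_letters_nseq_cat h j s :
  up_step_letters h (nseq j false ++ s) = up_step_letters (h - j) s.
Proof.
elim: j h => [|j IHj] h /=; first by rewrite subn0.
by rewrite IHj; congr up_step_letters; lia.
Qed.

Lemma path_of_lettersP h w : slowly_growing w -> nth 0 w 0 <= h ->
  descends_to_zero h (path_of_letters h w)
  /\ up_step_letters h (path_of_letters h w) = w.
Proof.
elim: w h => [|a w IHw] h /= slow_w le_ah.
  rewrite -[nseq h false]cats0 descends_to_zero_nseq_cat //.
  by rewrite up_step_letters_nseq_cat subnn.
have [Dw Ew] : descends_to_zero a.+1 (path_of_letters a.+1 w)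
    /\ up_step_letters a.+1 (path_of_letters a.+1 w) = w.
  by apply: IHw => [i|]; [exact: (slow_w i.+1) | exact: (slow_w 0)].
rewrite descends_to_zero_nseq_cat ?leq_subr // up_step_letters_nseq_cat.
by rewrite subKn //= Ew.
Qed.

Lemma size_descends_to_zero h s :
  descends_to_zero h s -> size s = h + (count id s).*2.
Proof.
elim: s h => [|[] s IHs] h /=; first by move/eqP->.
  by move/IHs->; lia.
by case/andP=> h_gt0 /IHs->; lia.
Qed.

Lemma descends_to_zero_rcons_true h s : ~~ descends_to_zero h (rcons s true).
Proof. by elim: s h => [|[] s IHs] h //=; rewrite negb_and IHs orbT. Qed.

(** Passes to the prefix counts by which [dyck_path] is defined. *)
Lemma descends_to_zeroP h s :
  descends_to_zero h s <->
    (forall i, count negb (take i s) <= h + count id (take i s))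
    /\ count negb s = h + count id s.
Proof.
elim: s h => [|[] s IHs] h /=.
- by split=> [/eqP->|[_]]; [|rewrite addn0 => <-].
- rewrite IHs; split=> -[below total]; split; try lia.
  + by case=> [|i] //=; have := below i; lia.
  + by move=> i; have /= := below i.+1; lia.
- split=> [/andP[h_gt0 /IHs[below total]]|[below total]].
    split; last lia.
    by case=> [|i] //=; have := below i; lia.
  have /= h_gt0 := below 1; rewrite take0 /= in h_gt0.
  apply/andP; split; first lia.
  apply/IHs; split; last lia.
  by move=> i; have /= := below i.+1; lia.
Qed.

(** The letter is the height where the north step starts: [h], plus the [i] north steps made before,
    minus the east steps made before, which are the growth of the abscissa from [x]. *)
Lemma nth_up_step_letters_abscissae h x s i :
    descends_to_zero h s -> i < count id s ->
  nth 0 (up_step_letters h s) i + nth 0 (north_abscissae x s) i = h + x + i.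
Proof.
elim: s h x i => [|[] s IHs] h x i //=.
  case: i => [|i] /= Ds lt_i; first by rewrite /letter_at_height addn0.
  by rewrite IHs //; lia.
by case/andP=> h_gt0 Ds lt_i; rewrite IHs //; lia.
Qed.

(** * Area words of reduced polyominoes *)

(** The common image of the two encodings, by which they are matched. *)
Definition is_area_word (m n : nat) (w : seq letter) : Prop :=
  [/\ size w = (m + n).+1, nth 0 w 0 = 0, slowly_growing w
    & count barred w = n].

Definition pair_steps (r g : seq bool) : seq bool :=
  flatten [seq [:: rg.1; ~~ rg.2] | rg <- zip r g].

Lemma pair_steps_inj r g r' g' :
    size r = size g -> size r' = size g' ->
  pair_steps r g = pair_steps r' g' -> r = r' /\ g = g'.
Proof.
rewrite /pair_steps.
elim: r g r' g' => [|b r IHr] [|c g] [|b' r'] [|c' g'] //=.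
move=> [Er] [Er'] [-> /negb_inj-> E].
by have [-> ->] := IHr _ _ _ Er Er' E.
Qed.

Lemma pair_steps_surj N t : size t = N.*2 ->
  {rg | [/\ size rg.1 = N, size rg.2 = N & pair_steps rg.1 rg.2 = t]}.
Proof.
elim: N t => [|N IHN] t; first by move/size0nil->; exists ([::], [::]).
case: t => [|b [|c t]] //= [/IHN[[r g] /= [Sr Sg Et]]].
exists (b :: r, ~~ c :: g); rewrite /= Sr Sg; split=> //.
by rewrite /pair_steps /= negbK -Et.
Qed.

(* Every pair of steps changes the height by an even amount, so the heights
   between pairs are odd, and positive as long as green stays below red. *)
Lemma descends_to_zero_pair_steps d r g : size r = size g ->
  descends_to_zero d.*2.+1 (pair_steps r g ++ [:: false]) <->
    (forall i, count id (take i g) <= d + count id (take i r))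
    /\ count id g = d + count id r.
Proof.
elim: r g d => [|b r IHr] [|c g] d //.
  by case: d => [|d]; split=> // -[].
move=> /succn_inj E.
have -> : descends_to_zero d.*2.+1 (pair_steps (b :: r) (c :: g) ++ [:: false])
    = (c <= d + b)
      && descends_to_zero (d + b - c).*2.+1 (pair_steps r g ++ [:: false]).
  rewrite /pair_steps /=; case: b; case: c; rewrite /= ?addn0 ?addn1 ?subn0.
  - by rewrite subn1.
  - by [].
  - by case: d => [|d] //; rewrite subn1.
  - by [].
split=> [/andP[le_c /(IHr _ _ E)[below total]]|[below /= total]].
  split=> /=; last lia.
  by case=> [|i] //=; have := below i; lia.
have /= le_c := below 1; rewrite !take0 /= in le_c.
apply/andP; split; first lia.
apply/(IHr _ _ E); split; last lia.
by move=> i; have /= := below i.+1; lia.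
Qed.

(** Each pair starts at an odd height, so an up step from [r] writes an odd letter, while the second
    step of the pair starts at an even height and can only write an unbarred one. *)
Lemma count_barred_pair_steps d r g : size r = size g ->
  descends_to_zero d.*2.+1 (pair_steps r g ++ [:: false]) ->
  count barred (up_step_letters d.*2.+1 (pair_steps r g ++ [:: false]))
  = count id r.
Proof.
elim: r g d => [|b r IHr] [|c g] d //= [E].
rewrite /pair_steps /=; case: b; case: c => /=.
- by move/IHr=> ->; rewrite // /barred /letter_at_height /= odd_double.
- move/(IHr _ d.+1)=> ->; rewrite // /barred /letter_at_height /=.
  by rewrite odd_double.
- by case: d => [|d] //= /IHr->.
- by move/IHr=> ->; rewrite // /barred /letter_at_height /= odd_double.
Qed.

Lemma descends_to_zero_polyomino m n (P : reduced_polyomino m n) :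
  descends_to_zero 1 (pair_steps (red P) (green P) ++ [:: false]).
Proof.
apply/(@descends_to_zero_pair_steps 0); first by rewrite !size_tuple.
split; last by rewrite (eqP (green_total P)) (eqP (red_total P)).
(* [green_below_red] covers only the prefixes of length 1 to [m + n]; the empty and the overlong
   ones are treated apart. *)
case=> [|i]; first by rewrite !take0.
have [lt_i|le_i] := ltnP i (m + n).
  exact: (forallP (green_below_red P) (Ordinal lt_i)).
rewrite !take_oversize ?size_tuple ?(leq_trans le_i) //.
by rewrite (eqP (green_total P)) (eqP (red_total P)).
Qed.

Lemma area_wordP m n (P : reduced_polyomino m n) :
  is_area_word m n (area_word P).
Proof.
split=> //; first exact: size_area_word.
- exact: slowly_growing_up_step_letters.
- rewrite /= (@count_barred_pair_steps 0) ?size_tuple //.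
    exact: (eqP (red_total P)).
  exact: descends_to_zero_polyomino.
Qed.

Lemma area_word_inj m n (P Q : reduced_polyomino m n) :
  area_word P = area_word Q -> P = Q.
Proof.
have := descends_to_zero_polyomino Q; have := descends_to_zero_polyomino P.
move=> DP DQ /(@up_step_letters_inj 0 (true :: _) (true :: _) DP DQ) [].
rewrite !cats1 => /rcons_inj[/pair_steps_inj[]]; rewrite ?size_tuple //.
case: P Q {DP DQ} => [r g bP gP rP] [r' g' bQ gQ rQ] /= /val_inj Er /val_inj Eg.
rewrite -{}Er -{}Eg in bQ gQ rQ *.
by congr ReducedPolyomino; exact: bool_irrelevance.
Qed.

Lemma area_word_surj m n w :
  is_area_word m n w -> {P : reduced_polyomino m n | area_word P = w}.
Proof.
move=> [size_w w0 slow_w count_w].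
have [] := @path_of_lettersP 0 w slow_w; first by rewrite w0.
move: (path_of_letters 0 w) => [|[] t] //= Dt Et; first by rewrite -Et in size_w.
(* A path ending at height 0 ends with a down step; between the first and last steps lie
   [(m + n).*2] steps, which are cut into pairs. *)
case/lastP: t Dt Et => [|t b] Dt Et //.
case: b Dt Et => [Dt|].
  by have := descends_to_zero_rcons_true 1 t; rewrite Dt.
rewrite -cats1 => Dt Et.
have size_t : size t = (m + n).*2.
  have := size_descends_to_zero Dt.
  rewrite -(size_up_step_letters 1) size_cat /=.
  have := congr1 size Et; rewrite size_w /=; lia.
have [[r g] /= [size_r size_g Ert]] := pair_steps_surj size_t.
have size_rg : size r = size g by rewrite size_r.
rewrite -{t size_t}Ert in Dt Et.
have [below total] := (@descends_to_zero_pair_steps 0 r g size_rg).1 Dt.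
have red_total : count id r = n.
  by rewrite -count_w -Et /= (@count_barred_pair_steps 0).
have Sr : size r == m + n by rewrite size_r.
have Sg : size g == m + n by rewrite size_g.
have below' : [forall i : 'I_(m + n),
    count id (take i.+1 (Tuple Sg)) <= count id (take i.+1 (Tuple Sr))].
  by apply/forallP=> i; exact: below.
have total_g : count id (Tuple Sg) == n by rewrite /= total red_total.
have total_r : count id (Tuple Sr) == n by rewrite /= red_total.
by exists (ReducedPolyomino below' total_g total_r).
Qed.

(** * Words of two cars parking functions *)

Definition rows_word N (F : parking_function N) : seq letter :=
  0 :: [seq al.1.*2 + (al.2 == 1) | al <- zip (up_step_letters 0 F) (labels F)].

Lemma count_north N (D : dyck_path N) : count id D = N.
Proof. by rewrite -[RHS](eqP (steps_north_total D)); apply: eq_count; case. Qed.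

Lemma count_mem_boolE (s : seq bool) :
  (count_mem false s = count negb s) * (count_mem true s = count id s).
Proof. by split; apply: eq_count; case. Qed.

Lemma descends_to_zero_dyck_path N (D : dyck_path N) : descends_to_zero 0 D.
Proof.
apply/descends_to_zeroP; split=> [i|].
  have [lt_i|le_i] := ltnP i (N + N).+1.
    by have := forallP (steps_above_diagonal D) (Ordinal lt_i); rewrite !count_mem_boolE.
  have := forallP (steps_above_diagonal D) ord_max.
  by rewrite !count_mem_boolE !take_oversize ?size_tuple // ltnW.
have := count_predC id D; rewrite size_tuple count_north => /addnI.
exact.
Qed.

(** The area of a row is the height at which its north step starts; the second equation shows that
    the subtraction in [row_area] is not truncated. *)
Lemma row_areaE N (D : dyck_path N) (i : 'I_N) :
  row_area D i = nth 0 (up_step_letters 0 D) i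
  /\ abscissa D i + row_area D i = i.
Proof.
have lt_i : i < count id D by rewrite count_north.
have := nth_up_step_letters_abscissae 0 (descends_to_zero_dyck_path D) lt_i.
by rewrite /row_area /abscissa; lia.
Qed.

Lemma size_rows_word N (F : parking_function N) : size (rows_word F) = N.+1.
Proof.
by rewrite /= size_map size_zip size_up_step_letters count_north size_tuple minnn.
Qed.

Lemma nth_rows_word N (F : parking_function N) (i : 'I_N) :
  nth 0 (rows_word F) i.+1 = (row_area F i).*2 + (tnth (labels F) i == 1).
Proof.
have size_al : size (up_step_letters 0 F) = size (labels F).
  by rewrite size_up_step_letters count_north size_tuple.
rewrite /= (nth_map (0, 0)); last by rewrite size_zip size_al minnn size_tuple.
by rewrite nth_zip //= (row_areaE _ _).1 (tnth_nth 0).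
Qed.

Lemma two_cars_label N (l : N.-tuple nat) (i : 'I_N) :
  all (mem [:: 1; 2]) l -> tnth l i = 1 \/ tnth l i = 2.
Proof.
by move/all_tnthP/(_ i); rewrite /= !inE => /orP[]/eqP; [left | right].
Qed.

(** Area and row index both grow by one, so the abscissa is unchanged and the rows share a
    column. *)
Lemma row_area_rise N (F : parking_function N) (i j : 'I_N) :
    j = i.+1 :> nat -> row_area F j = (row_area F i).+1 ->
  tnth (labels F) i < tnth (labels F) j.
Proof.
move=> Ej rise.
have /forallP/(_ i)/forallP/(_ j)/implyP := labels_increasing F; apply.
rewrite Ej eqxx /=.
by have := (row_areaE F i).2; have := (row_areaE F j).2; lia.
Qed.

Lemma rows_wordP m n (F : parking_function (m + n)) :
    all (mem [:: 1; 2]) (labels F) -> count_mem 1 (labels F) = n ->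
  is_area_word m n (rows_word F).
Proof.
move=> cars ones; split=> //; first exact: size_rows_word.
- move=> i; have [lt_i|le_i] := ltnP i (m + n); last first.
    by rewrite nth_default // size_rows_word.
  rewrite (nth_rows_word F (Ordinal lt_i)).
  case: i lt_i => [|i] lt_i.
    have := (row_areaE F (Ordinal lt_i)).2 => /=.
    by case: (_ == 1); lia.
  rewrite (nth_rows_word F (Ordinal (ltnW lt_i))).
  set j := Ordinal lt_i; set i' := Ordinal _.
  have le_a : row_area F j <= (row_area F i').+1.
    rewrite (row_areaE F j).1 (row_areaE F i').1.
    exact: slowly_growing_up_step_letters.
  have rise : row_area F j = (row_area F i').+1 ->
    tnth (labels F) i' < tnth (labels F) j by exact: row_area_rise.
  (* If the area grows, the labels are 1 then 2 and the letter goes from [2a + 1] to [2a + 2];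
     otherwise the value does not grow, and the letter grows by at most one. *)
  have := two_cars_label i' cars; have := two_cars_label j cars.
  by case: eqP => ?; case: eqP => ?; lia.
- rewrite /= count_map -[RHS]ones.
  rewrite -[in RHS](@unzip2_zip _ _ (up_step_letters 0 F) (labels F)).
    rewrite count_map; apply: eq_count => -[a l] /=.
    by rewrite /barred oddD odd_double oddb.
  by rewrite size_up_step_letters count_north size_tuple.
Qed.

Lemma rows_word_inj N (F G : parking_function N) :
    all (mem [:: 1; 2]) (labels F) -> all (mem [:: 1; 2]) (labels G) ->
  rows_word F = rows_word G -> F = G.
Proof.
move=> carsF carsG E.
(* The parity of a letter gives the label, its half the area. *)
have eq_row i : (row_area F i = row_area G i)
    /\ tnth (labels F) i = tnth (labels G) i.
  have := congr1 (fun w => nth 0 w i.+1) E; rewrite !nth_rows_word.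
  have := two_cars_label i carsF; have := two_cars_label i carsG.
  by case: eqP => ?; case: eqP => ?; lia.
have eq_labels : labels F = labels G by apply: eq_from_tnth => i; case: (eq_row i).
have eq_path : steps F = steps G.
  apply: val_inj; apply: (@up_step_letters_inj 0).
  - exact: descends_to_zero_dyck_path.
  - exact: descends_to_zero_dyck_path.
  apply: (@eq_from_nth _ 0); first by rewrite !size_up_step_letters !count_north.
  rewrite size_up_step_letters count_north => i lt_i.
  have := (eq_row (Ordinal lt_i)).1.
  by rewrite (row_areaE F _).1 (row_areaE G _).1.
case: F G eq_labels eq_path {carsF carsG E eq_row}.
move=> [s aF nF] l pF iF [[s' aG nG] l' pG iG] /= El Es.
rewrite -{}El -{}Es in aG nG pG iG *.
rewrite (bool_irrelevance aG aF) (bool_irrelevance nG nF) in iG *.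
by congr ParkingFunction; exact: bool_irrelevance.
Qed.

Lemma rows_word_surj m n w : is_area_word m n w ->
  {F : parking_function (m + n) |
    [/\ all (mem [:: 1; 2]) (labels F), count_mem 1 (labels F) = n,
      count_mem 2 (labels F) = m & rows_word F = w]}.
Proof.
case: w => [|a0 w] [] //= [size_w] a0_0 slow_w; rewrite {}a0_0 in slow_w *.
rewrite /= add0n => count_w.
set a := [seq half c | c <- w]; set l := [seq (~~ odd c).+1 | c <- w].
have slow_a : slowly_growing a.
  move=> i; have := slow_w i.+1; rewrite /=.
  have [lt_i|le_i] := ltnP i.+1 (size w); last first.
    by rewrite [nth 0 a _]nth_default ?size_map.
  by have lt_i1 := ltnW lt_i; rewrite /a !(nth_map 0) //; lia.
have [|Da Ea] := @path_of_lettersP 0 a slow_a.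
  (* The letter after the initial 0 has rank at most 1, hence value 0. *)
  by have := slow_w 0; rewrite /a; case: (w) => [|c w'] //=; lia.
move: (path_of_letters 0 a) Da Ea => s Ds Es.
have count_s : count id s = m + n.
  by rewrite -(size_up_step_letters 0) Es size_map.
have size_s : size s == (m + n) + (m + n).
  by rewrite (size_descends_to_zero Ds) count_s addnn.
have above : [forall i : 'I_(m + n + (m + n)).+1,
    count_mem false (take i (Tuple size_s)) <= count_mem true (take i (Tuple size_s))].
  by apply/forallP=> i; rewrite !count_mem_boolE; exact: ((descends_to_zeroP 0 s).1 Ds).1.
have total : count_mem true (Tuple size_s) == m + n by rewrite count_mem_boolE count_s.
pose D := DyckPath above total.
have size_l : size l == m + n by rewrite size_map size_w.
have pos : all (leq 1) (Tuple size_l) by rewrite /= all_map; apply/allP.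
have inc : [forall i : 'I_(m + n), forall j : 'I_(m + n),
    (j == i.+1 :> nat) && (abscissa D i == abscissa D j)
    ==> (tnth (Tuple size_l) i < tnth (Tuple size_l) j)].
  apply/forallP=> i; apply/forallP=> j; apply/implyP=> /andP[/eqP Ej /eqP Ex].
  (* Equal abscissae make the value grow by one while the rank grows by at most one: the letter of
     row [i] is odd and that of row [j] even, so the labels are 1 and 2. *)
  have [rj xj] := row_areaE D j; have [ri xi] := row_areaE D i.
  have lt_j : j < size w by rewrite size_w.
  have lt_i : i < size w by rewrite size_w.
  rewrite /= Es !(nth_map 0) // in ri rj.
  rewrite !(tnth_nth 0) /= !(nth_map 0) //.
  by have := slow_w i.+1; rewrite /= -Ej; lia.
exists (ParkingFunction pos inc); split=> /=.
- by rewrite all_map; apply/allP=> c _ /=; rewrite !inE; case: odd.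
- by rewrite -[RHS]count_w count_map; apply: eq_count => c /=; rewrite /barred; case: odd.
- have := count_predC barred w; rewrite size_w count_w addnC => /addIn <-.
  by rewrite count_map; apply: eq_count => c /=; rewrite /barred; case: odd.
- rewrite /rows_word /= Es; congr (_ :: _).
  rewrite /a /l zip_map -map_comp -[RHS]map_id; apply: eq_map => c /=; lia.
Qed.

(** * Transfer of rises, area and dinv *)

(** Row [i] is the letter at position [i.+1], the second letter of the rise indexed by [i], so
    decorations carry over without reindexing. At index 0 neither side has a rise, the initial 0
    being unbarred. *)
Lemma rise_eq m n (P : reduced_polyomino m n) (F : parking_function (m + n)) :
    all (mem [:: 1; 2]) (labels F) -> rows_word F = area_word P ->
  polyomino_rise P =1 parking_rise F.
Proof.
move=> cars E i; rewrite /polyomino_rise -E nth_rows_word /successor.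
case: i => [[|i] lt_i] /=.
  by apply/esym/existsP=> -[j].
set i1 := Ordinal lt_i; pose i0 := Ordinal (ltnW lt_i).
have -> : nth 0 [seq al.1.*2 + (al.2 == 1)
    | al <- zip (up_step_letters 0 F) (labels F)] i
  = (row_area F i0).*2 + (tnth (labels F) i0 == 1).
  exact: (nth_rows_word F i0).
have -> : parking_rise F i1 = (row_area F i1 == (row_area F i0).+1).
  apply/existsP/idP => [[j /andP[/eqP[Ej]]]|rise].
    by have -> : i0 = j by apply: val_inj.
  by exists i0; rewrite eqxx.
have rise := @row_area_rise _ F i0 i1 erefl.
have := two_cars_label i0 cars; have := two_cars_label i1 cars.
by rewrite /barred; case: eqP => ?; case: eqP => ?; lia.
Qed.

Lemma area_eq m n k (P : decorated_polyomino m n k) (F : decorated_two_cars m n k) :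
    rows_word F = area_word P -> parking_decoration F = polyomino_decoration P ->
  parking_area F = polyomino_area P.
Proof.
move=> E Edeco; rewrite /parking_area /polyomino_area /marked -E Edeco.
rewrite [RHS]big_mkcond big_ord_recl [LHS]big_mkcond.
(* The initial letter contributes 0, marked or not. *)
have -> b : (if b then value (nth 0 (rows_word F) ord0) else 0) = 0 by case: b.
apply: eq_bigr => i _.
rewrite mem_imset; last exact: lift_inj.
rewrite lift0 nth_rows_word.
by case: ifP => // _; rewrite /value; case: eqP; lia.
Qed.

Lemma dinv_eq m n k (P : decorated_polyomino m n k) (F : decorated_two_cars m n k) :
  rows_word F = area_word P -> parking_dinv F = polyomino_dinv P.
Proof.
move=> E; rewrite /parking_dinv /polyomino_dinv -E.
pose shift (p : 'I_(m + n) * 'I_(m + n)) := (lift ord0 p.1, lift ord0 p.2).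
have shift_inj : injective shift.
  move=> [i j] [i' j'] Eij.
  have /lift_inj/= -> := congr1 fst Eij; have /lift_inj/= -> := congr1 snd Eij.
  by [].
rewrite -(card_imset _ shift_inj); apply: eq_card => -[i j].
(* Position 0 occurs in no counted pair: on the left its letter 0 succeeds nothing, and on the right
   nothing precedes it. *)
case: (unliftP ord0 i) => [i'|] ->; last first.
  rewrite inE [RHS]andbF; apply/imsetP => -[[i' j'] _ /(congr1 fst)/= /eqP].
  by rewrite (negbTE (neq_lift _ _)).
case: (unliftP ord0 j) => [j'|] ->; last first.
  rewrite inE /=; apply/imsetP => -[[i'' j''] _ /(congr1 snd)/= /eqP].
  by rewrite (negbTE (neq_lift _ _)).
rewrite (mem_imset _ (i', j') shift_inj) !inE !lift0 ltnS !nth_rows_word.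
(* A letter succeeds another either with equal areas and labels 1, 2, or with area larger by one and
   labels 2, 1: the two clauses of [parking_dinv]. *)
have := two_cars_label i' (two_cars F); have := two_cars_label j' (two_cars F).
by rewrite /successor /=; case: (i' < j') => //= -[]-> -[]-> /=; lia.
Qed.

(** * The bijection between decorated objects *)

Lemma decorated_polyomino_inj m n k (P Q : decorated_polyomino m n k) :
    area_word P = area_word Q ->
  polyomino_decoration P = polyomino_decoration Q -> P = Q.
Proof.
case: P Q => [P S subP cardP] [Q T subQ cardQ] /= /area_word_inj EP ES.
rewrite -{}EP -{}ES in subQ cardQ *.
by congr DecoratedPolyomino; exact: bool_irrelevance.
Qed.

Lemma decorated_two_cars_inj m n k (F G : decorated_two_cars m n k) :
    rows_word F = rows_word G ->
  parking_decoration F = parking_decoration G -> F = G.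
Proof.
case: F G => [F cF oF tF S subF cardF] [G cG oG tG T subG cardG] /=.
move=> /(rows_word_inj cF cG) EF ES.
rewrite -{}EF -{}ES in cG oG tG subG cardG *.
by f_equal; exact: bool_irrelevance.
Qed.

Lemma two_cars_of_polyomino m n k (P : decorated_polyomino m n k) :
  {F : decorated_two_cars m n k | rows_word F = area_word P
    & parking_decoration F = polyomino_decoration P}.
Proof.
have [F [cars /eqP ones /eqP twos EF]] := rows_word_surj (area_wordP P).
have sub : polyomino_decoration P \subset parking_rise F.
  rewrite -(eq_subset_r (rise_eq cars EF)); exact: polyomino_decorationP.
by exists (DecoratedTwoCars cars ones twos sub (polyomino_decoration_card P)).
Qed.

Lemma polyomino_of_two_cars m n k (F : decorated_two_cars m n k) :
  {P : decorated_polyomino m n k | area_word P = rows_word F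
    & polyomino_decoration P = parking_decoration F}.
Proof.
have [P EP] := area_word_surj (rows_wordP (two_cars F) (eqP (labels_one F))).
have sub : parking_decoration F \subset polyomino_rise P.
  rewrite (eq_subset_r (rise_eq (two_cars F) (esym EP))).
  exact: parking_decorationP.
by exists (DecoratedPolyomino sub (parking_decoration_card F)).
Qed.

Theorem theorem2p1 (m n k : nat) :
  exists f : decorated_polyomino m n k -> decorated_two_cars m n k,
    bijective f /\
    forall P : decorated_polyomino m n k,
      (parking_dinv (f P), parking_area (f P))
      = (polyomino_dinv P, polyomino_area P).
Proof.
exists (fun P => s2val (two_cars_of_polyomino P)); split=> [|P].
  (* Both maps keep the word and the decoration, which determine the object on either side, so they
     are mutually inverse. *)
  exists (fun F => s2val (polyomino_of_two_cars F)) => [P|F].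
    case: two_cars_of_polyomino => F /= EF SF.
    case: polyomino_of_two_cars => Q /= EQ SQ.
    by apply: decorated_polyomino_inj; rewrite (EQ, SQ).
  case: polyomino_of_two_cars => P /= EP SP.
  case: two_cars_of_polyomino => G /= EG SG.
  by apply: decorated_two_cars_inj; rewrite (EG, SG).
case: two_cars_of_polyomino => F /= EF SF.
by rewrite (dinv_eq EF) (area_eq EF SF).
Qed.
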